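(* The functor $L\colon\mathbf{Lab}\to\mathbf{Volt}$ from the category of group labeled graphs to the category of voltage graphs, given on objects by $L(G,\Gamma,\beta)=(G,\Gamma,\alpha)$ with $\alpha(d)=\beta(s(d))^{-1}\beta(t(d))$ for every dart $d\in D(G)$, and on morphisms by $L(f,h)=(f,h)$, is a left adjoint functor (i.e. there is a functor $R\colon\mathbf{Volt}\to\mathbf{Lab}$ with $L\dashv R$).
   Context: A graph is a quintuple $G=(V,D,s,t,\lambda)$ where $V=V(G)$ is a set (vertices), $D=D(G)$ is a set (darts), $s,t\colon D\to V$ are maps (source and target), and $\lambda\colon D\to D$ is a map with $\lambda\circ\lambda=\mathrm{id}_D$ and $s\circ\lambda=t$. A morphism of graphs $f\colon G\to H$ is a pair of maps $f^V\colon V(G)\to V(H)$, $f^D\colon D(G)\to D(H)$ such that for all $d\in D(G)$: $s(f^D(d))=f^V(s(d))$, $t(f^D(d))=f^V(t(d))$, $\lambda(f^D(d))=f^D(\lambda(d))$. $\mathbf{Lab}$ is the category of group labeled graphs: objects are triples $(G,\Gamma,\beta)$ with $G$ a graph, $\Gamma$ a group and $\beta\colon V(G)\to\Gamma$ a map; a morphism $(G,\Gamma,\beta)\to(G',\Gamma',\beta')$ is a pair $(f,h)$ with $f\colon G\to G'$ a morphism of graphs and $h\colon\Gamma\to\Gamma'$ a group homomorphism such that $h(\beta(v))=\beta'(f^V(v))$ for all $v\in V(G)$; composition is componentwise. $\mathbf{Volt}$ is the category of voltage graphs: objects are triples $(G,\Gamma,\alpha)$ with $G$ a graph, $\Gamma$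 a group and $\alpha\colon D(G)\to\Gamma$ a map such that $\alpha(\lambda(d))=\alpha(d)^{-1}$ for all $d\in D(G)$; a morphism $(G,\Gamma,\alpha)\to(G',\Gamma',\alpha')$ is a pair $(f,h)$ with $f\colon G\to G'$ a morphism of graphs and $h\colon\Gamma\to\Gamma'$ a group homomorphism such that $h(\alpha(d))=\alpha'(f^D(d))$ for all $d\in D(G)$; composition is componentwise. *)

(* Defs.v *)
From HB Require Import structures.
From mathcomp Require Import all_boot.
From mathcomp Require Import boolp.

Set Implicit Arguments.
Unset Strict Implicit.
Unset Printing Implicit Defensive.

Local Open Scope group_scope.

(* Categories, functors and adjunctions. Morphisms are compared with Leibniz
   equality; [comp g f] is "g after f". *)

Record category := Category {
  obj :> Type;
  hom : obj -> obj -> Type;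
  idm : forall X, hom X X;
  comp : forall X Y Z, hom Y Z -> hom X Y -> hom X Z;
  comp_idl : forall X Y (f : hom X Y), comp (idm Y) f = f;
  comp_idr : forall X Y (f : hom X Y), comp f (idm X) = f;
  compA : forall X Y Z W (h : hom Z W) (g : hom Y Z) (f : hom X Y),
    comp h (comp g f) = comp (comp h g) f
}.
Arguments hom {c} _ _.
Arguments idm {c} _.
Arguments comp {c X Y Z} _ _.

Record functor (C D : category) := Functor {
  fobj :> C -> D;
  fmap : forall X Y : C, hom X Y -> hom (fobj X) (fobj Y);
  fmap_id : forall X : C, fmap (idm X) = idm (fobj X);
  fmap_comp : forall (X Y Z : C) (g : hom Y Z) (f : hom X Y),
    fmap (comp g f) = comp (fmap g) (fmap f)
}.
Arguments fmap {C D} _ {X Y} _.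

(* Hom-set adjunction: a bijection D(L X, Y) -> C(X, R Y), natural in X and
   in Y. *)
Record adjunction (C D : category) (L : functor C D) (R : functor D C) :=
  Adjunction {
  transpose : forall (X : C) (Y : D), hom (L X) Y -> hom X (R Y);
  transpose_bij : forall (X : C) (Y : D), bijective (@transpose X Y);
  transpose_natl : forall (X X' : C) (Y : D) (f : hom X' X) (u : hom (L X) Y),
    transpose (comp u (fmap L f)) = comp (transpose u) f;
  transpose_natr : forall (X : C) (Y Y' : D) (g : hom Y Y') (u : hom (L X) Y),
    transpose (comp g u) = comp (fmap R g) (transpose u)
}.

Definition adjoint (C D : category) (L : functor C D) (R : functor D C) : Prop :=
  inhabited (adjunction L R).

Definition is_left_adjoint (C D : category) (L : functor C D) : Prop :=
  exists R : functor D C, adjoint L R.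

Record graph := Graph {
  vertex : Type;
  dart : Type;
  source : dart -> vertex;
  target : dart -> vertex;
  flip : dart -> dart;
  flipK : involutive flip;
  source_flip : forall d, source (flip d) = target d
}.
Arguments source {g} _.
Arguments target {g} _.
Arguments flip {g} _.

Record graph_hom (G H : graph) := GraphHom {
  vmap : vertex G -> vertex H;
  dmap : dart G -> dart H;
  source_dmap : forall d, source (dmap d) = vmap (source d);
  target_dmap : forall d, target (dmap d) = vmap (target d);
  flip_dmap : forall d, flip (dmap d) = dmap (flip d)
}.

Lemma graph_hom_eq (G H : graph) (f g : graph_hom G H) :
  vmap f = vmap g -> dmap f = dmap g -> f = g.
Proof.
case: f g => [v d ? ? ?] [v' d' ? ? ?] /= ev ed; subst v' d'.
by congr GraphHom; exact: Prop_irrelevance.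
Qed.

Definition graph_id (G : graph) : graph_hom G G :=
  @GraphHom G G id id (fun=> erefl) (fun=> erefl) (fun=> erefl).

Section GraphComp.
Variables (G H K : graph) (g : graph_hom H K) (f : graph_hom G H).

Lemma graph_comp_source d :
  source ((dmap g \o dmap f) d) = (vmap g \o vmap f) (source d).
Proof. by rewrite /= !source_dmap. Qed.

Lemma graph_comp_target d :
  target ((dmap g \o dmap f) d) = (vmap g \o vmap f) (target d).
Proof. by rewrite /= !target_dmap. Qed.

Lemma graph_comp_flip d :
  flip ((dmap g \o dmap f) d) = (dmap g \o dmap f) (flip d).
Proof. by rewrite /= !flip_dmap. Qed.

Definition graph_comp : graph_hom G K :=
  GraphHom graph_comp_source graph_comp_target graph_comp_flip.

End GraphComp.

(* Groups are MathComp's (possibly infinite) groups. Their carrier is a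
   choiceType; classically every type has such a structure, and homomorphisms
   ignore it, so no group is excluded. *)
Notation group_hom := UMagmaMorphism.type.

Lemma group_hom_eq (A B : groupType) (f g : group_hom A B) : f =1 g -> f = g.
Proof.
case: f g => [f [[fM] [f1]]] [g [[gM] [g1]]] /= /funext efg; subst g.
by rewrite (Prop_irrelevance gM fM) (Prop_irrelevance g1 f1).
Qed.

Definition group_id (A : groupType) : group_hom A A := idfun.

Definition group_comp (A B C : groupType) (g : group_hom B C)
  (f : group_hom A B) : group_hom A C := g \o f.

Record labeled_graph := LabeledGraph {
  lgraph : graph;
  lgroup : groupType;
  label : vertex lgraph -> lgroup
}.
Arguments label {l} _.

Record lab_hom (X Y : labeled_graph) := LabHom {
  lab_graph_hom : graph_hom (lgraph X) (lgraph Y);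
  lab_group_hom : group_hom (lgroup X) (lgroup Y);
  lab_homP : forall v, lab_group_hom (label v) = label (vmap lab_graph_hom v)
}.

Lemma lab_hom_eq (X Y : labeled_graph) (a b : lab_hom X Y) :
  lab_graph_hom a = lab_graph_hom b -> lab_group_hom a = lab_group_hom b ->
  a = b.
Proof.
case: a b => [f h ?] [f' h' ?] /= ef eh; subst f' h'.
by congr LabHom; exact: Prop_irrelevance.
Qed.

Definition lab_id (X : labeled_graph) : lab_hom X X :=
  @LabHom X X (graph_id _) (group_id _) (fun=> erefl).

Lemma lab_comp_subproof (X Y Z : labeled_graph) (b : lab_hom Y Z)
    (a : lab_hom X Y) v :
  group_comp (lab_group_hom b) (lab_group_hom a) (label v) =
  label (vmap (graph_comp (lab_graph_hom b) (lab_graph_hom a)) v).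
Proof. by rewrite /= !lab_homP. Qed.

Definition lab_comp (X Y Z : labeled_graph) (b : lab_hom Y Z)
  (a : lab_hom X Y) : lab_hom X Z := LabHom (lab_comp_subproof b a).

Definition Lab : category.
Proof.
refine (@Category labeled_graph lab_hom lab_id lab_comp _ _ _) => *;
  by apply: lab_hom_eq; [apply: graph_hom_eq | apply: group_hom_eq].
Defined.

Record voltage_graph := VoltageGraph {
  vgraph : graph;
  vgroup : groupType;
  voltage : dart vgraph -> vgroup;
  voltage_flip : forall d, voltage (flip d) = (voltage d)^-1
}.
Arguments voltage {v} _.

Record volt_hom (X Y : voltage_graph) := VoltHom {
  volt_graph_hom : graph_hom (vgraph X) (vgraph Y);
  volt_group_hom : group_hom (vgroup X) (vgroup Y);
  volt_homP : forall d,
    volt_group_hom (voltage d) = voltage (dmap volt_graph_hom d)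
}.

Lemma volt_hom_eq (X Y : voltage_graph) (a b : volt_hom X Y) :
  volt_graph_hom a = volt_graph_hom b -> volt_group_hom a = volt_group_hom b ->
  a = b.
Proof.
case: a b => [f h ?] [f' h' ?] /= ef eh; subst f' h'.
by congr VoltHom; exact: Prop_irrelevance.
Qed.

Definition volt_id (X : voltage_graph) : volt_hom X X :=
  @VoltHom X X (graph_id _) (group_id _) (fun=> erefl).

Lemma volt_comp_subproof (X Y Z : voltage_graph) (b : volt_hom Y Z)
    (a : volt_hom X Y) d :
  group_comp (volt_group_hom b) (volt_group_hom a) (voltage d) =
  voltage (dmap (graph_comp (volt_graph_hom b) (volt_graph_hom a)) d).
Proof. by rewrite /= !volt_homP. Qed.

Definition volt_comp (X Y Z : voltage_graph) (b : volt_hom Y Z)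
  (a : volt_hom X Y) : volt_hom X Z := VoltHom (volt_comp_subproof b a).

Definition Volt : category.
Proof.
refine (@Category voltage_graph volt_hom volt_id volt_comp _ _ _) => *;
  by apply: volt_hom_eq; [apply: graph_hom_eq | apply: group_hom_eq].
Defined.

Definition label_voltage (X : labeled_graph) (d : dart (lgraph X)) : lgroup X :=
  (label (source d))^-1 * label (target d).

Lemma label_voltage_flip (X : labeled_graph) (d : dart (lgraph X)) :
  label_voltage (flip d) = (label_voltage d)^-1.
Proof.
by rewrite /label_voltage invgM invgK source_flip -(source_flip (flip d)) flipK.
Qed.

Definition L_obj (X : labeled_graph) : voltage_graph :=
  VoltageGraph (@label_voltage_flip X).

Lemma L_hom_subproof (X Y : labeled_graph) (a : lab_hom X Y)
    (d : dart (lgraph X)) :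
  lab_group_hom a (label_voltage d) =
  label_voltage (dmap (lab_graph_hom a) d).
Proof.
by rewrite /label_voltage gmulfM gmulfV !lab_homP source_dmap target_dmap.
Qed.

Definition L_hom (X Y : labeled_graph) (a : lab_hom X Y) :
    volt_hom (L_obj X) (L_obj Y) :=
  @VoltHom (L_obj X) (L_obj Y) (lab_graph_hom a) (lab_group_hom a)
    (L_hom_subproof a).

Definition L : functor Lab Volt.
Proof.
refine (@Functor Lab Volt L_obj L_hom _ _) => *;
  by apply: volt_hom_eq.
Defined.

(* Main.v *)
From mathcomp Require Import all_boot.
From mathcomp Require Import boolp.
Require Import Defs.

Set Implicit Arguments.
Unset Strict Implicit.
Unset Printing Implicit Defensive.

Local Open Scope group_scope.

(** The right adjoint sends a voltage graph to its derived (covering) graph,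
    whose vertices and darts carry an extra group coordinate, labeled by that
    coordinate. A morphism [(f, h)] out of [L X] lifts uniquely: the group
    coordinate over a vertex [v] must be [h (label v)], and the voltage
    condition is exactly what makes this lift compatible with targets. *)

Section DerivedGraph.
Variable Y : voltage_graph.

Definition derived_source (d : dart (vgraph Y) * vgroup Y) :=
  (source d.1, d.2).

Definition derived_target (d : dart (vgraph Y) * vgroup Y) :=
  (target d.1, d.2 * voltage d.1).

(** The reversed dart must start at the group coordinate where the original one ends, hence the
    shift by [voltage d.1]; [voltage_flip] makes the shifts of two successive reversals cancel. *)
Definition derived_flip (d : dart (vgraph Y) * vgroup Y) :=
  (flip d.1, d.2 * voltage d.1).

Lemma derived_flipK : involutive derived_flip.
Proof. by case=> d x; rewrite /derived_flip /= flipK voltage_flip mulgK. Qed.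

Lemma derived_source_flip d :
  derived_source (derived_flip d) = derived_target d.
Proof. by rewrite /derived_source /= source_flip. Qed.

Definition derived_graph : graph := Graph derived_flipK derived_source_flip.

Definition derived_labeled_graph : labeled_graph :=
  @LabeledGraph derived_graph (vgroup Y) snd.

End DerivedGraph.

Section DerivedHom.
Variables (Y Y' : voltage_graph) (a : volt_hom Y Y').

Definition derived_vmap (v : vertex (derived_graph Y)) :
    vertex (derived_graph Y') :=
  (vmap (volt_graph_hom a) v.1, volt_group_hom a v.2).

Definition derived_dmap (d : dart (derived_graph Y)) :
    dart (derived_graph Y') :=
  (dmap (volt_graph_hom a) d.1, volt_group_hom a d.2).

Lemma derived_dmap_source d :
  source (derived_dmap d) = derived_vmap (source d).
Proof. by rewrite /= /derived_source /= source_dmap. Qed.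

Lemma derived_dmap_target d :
  target (derived_dmap d) = derived_vmap (target d).
Proof.
by rewrite /= /derived_target /derived_vmap /= target_dmap gmulfM volt_homP.
Qed.

Lemma derived_dmap_flip d : flip (derived_dmap d) = derived_dmap (flip d).
Proof.
by rewrite /= /derived_flip /derived_dmap /= flip_dmap gmulfM volt_homP.
Qed.

Definition derived_hom :
    lab_hom (derived_labeled_graph Y) (derived_labeled_graph Y') :=
  @LabHom (derived_labeled_graph Y) (derived_labeled_graph Y')
    (GraphHom derived_dmap_source derived_dmap_target derived_dmap_flip)
    (volt_group_hom a) (fun=> erefl).

End DerivedHom.

Definition derived_functor : functor Volt Lab.
Proof.
refine (@Functor Volt Lab derived_labeled_graph derived_hom _ _) => *;
  by apply: lab_hom_eq => //; apply: graph_hom_eq; apply/funext=> -[].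
Defined.

Section Transpose.
Variables (X : labeled_graph) (Y : voltage_graph).

Section Lift.
Variable u : volt_hom (L_obj X) Y.

Definition lift_vmap (v : vertex (lgraph X)) : vertex (derived_graph Y) :=
  (vmap (volt_graph_hom u) v, volt_group_hom u (label v)).

(** The group coordinate is forced: [derived_source] leaves it unchanged, so it must equal that of
    the lifted source vertex. *)
Definition lift_dmap (d : dart (lgraph X)) : dart (derived_graph Y) :=
  (dmap (volt_graph_hom u) d, volt_group_hom u (label (source d))).

(** By [volt_homP], the voltage of the image dart is the image of
    [(label (source d))^-1 * label (target d)], so the product telescopes. Compatibility with
    targets and with flips both rest on this, since both shift the group coordinate by the
    voltage. *)
Lemma lift_label_target d :
  volt_group_hom u (label (source d)) * voltage (dmap (volt_graph_hom u) d) =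
  volt_group_hom u (label (target d)).
Proof. by rewrite -volt_homP -gmulfM /= /label_voltage mulVKg. Qed.

Lemma lift_dmap_source d : source (lift_dmap d) = lift_vmap (source d).
Proof. by rewrite /= /derived_source /= source_dmap. Qed.

Lemma lift_dmap_target d : target (lift_dmap d) = lift_vmap (target d).
Proof. by rewrite /= /derived_target /= lift_label_target target_dmap. Qed.

Lemma lift_dmap_flip d : flip (lift_dmap d) = lift_dmap (flip d).
Proof.
by rewrite /= /derived_flip /lift_dmap /= lift_label_target flip_dmap source_flip.
Qed.

Definition lift_hom : lab_hom X (derived_labeled_graph Y) :=
  @LabHom X (derived_labeled_graph Y)
    (GraphHom lift_dmap_source lift_dmap_target lift_dmap_flip)
    (volt_group_hom u) (fun=> erefl).

End Lift.

Section Project.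
Variable b : lab_hom X (derived_labeled_graph Y).

Definition project_vmap (v : vertex (lgraph X)) : vertex (vgraph Y) :=
  (vmap (lab_graph_hom b) v).1.

Definition project_dmap (d : dart (lgraph X)) : dart (vgraph Y) :=
  (dmap (lab_graph_hom b) d).1.

Lemma project_dmap_source d :
  source (project_dmap d) = project_vmap (source d).
Proof. by rewrite /project_vmap -source_dmap. Qed.

Lemma project_dmap_target d :
  target (project_dmap d) = project_vmap (target d).
Proof. by rewrite /project_vmap -target_dmap. Qed.

Lemma project_dmap_flip d : flip (project_dmap d) = project_dmap (flip d).
Proof. by rewrite /project_dmap -flip_dmap. Qed.

(** Since [b] preserves labels, the left side can be computed on the image dart. A dart [(e, x)] of
    the derived graph runs from label [x] to label [x * voltage e], and [x] cancels. *)
Lemma project_homP d :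
  lab_group_hom b (label_voltage d) = voltage (project_dmap d).
Proof.
by rewrite gmulfM gmulfV !lab_homP -source_dmap -target_dmap /= mulKg.
Qed.

Definition project_hom : volt_hom (L_obj X) Y :=
  @VoltHom (L_obj X) Y
    (GraphHom project_dmap_source project_dmap_target project_dmap_flip)
    (lab_group_hom b) project_homP.

End Project.

Lemma lift_homK : cancel lift_hom project_hom.
Proof. by move=> u; apply: volt_hom_eq => //; apply: graph_hom_eq. Qed.

(** The discarded group coordinate can be recovered: over a vertex it is the label, which [b]
    preserves, and over a dart it is the label of the source. *)
Lemma project_homK : cancel project_hom lift_hom.
Proof.
move=> b; apply: lab_hom_eq => //; apply: graph_hom_eq; apply/funext.
  by move=> v; rewrite /= /lift_vmap /= lab_homP -surjective_pairing.
move=> d; rewrite /= /lift_dmap /= lab_homP -source_dmap.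
by rewrite -surjective_pairing.
Qed.

End Transpose.

Lemma L_derived_adjunction : adjunction L derived_functor.
Proof.
refine (@Adjunction Lab Volt L derived_functor lift_hom _ _ _).
- by move=> X Y; exists (@project_hom X Y);
    [exact: lift_homK | exact: project_homK].
- move=> X X' Y f u; apply: lab_hom_eq; last exact: group_hom_eq.
  (* The group coordinates agree because [f] preserves labels; only the dart case needs
     [source_dmap] first, to move the source past [f]. *)
  by apply: graph_hom_eq; apply/funext=> z;
    rewrite /= /lift_vmap /lift_dmap /= ?source_dmap lab_homP.
(* Here both sides apply the group homomorphism of [g] to the same lifted coordinate, so they agree
   by computation. *)
- move=> X Y Y' g u; apply: lab_hom_eq; last exact: group_hom_eq.
  exact: graph_hom_eq.
Qed.

Theorem theorem3p2 : is_left_adjoint L.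
Proof. exact: (ex_intro _ derived_functor (inhabits L_derived_adjunction)). Qed.
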